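(* Let $n\geq 1$ and $N\geq 1$ be integers such that $s_{2}(n+2^{N-1})\geq 2^{N}$. Then $\mathrm{v}(n)\equiv 0 \pmod{2^{N}}$.
   Context: For a positive integer $n$, $\mathrm{v}(n)$ denotes the number of compositions (ordered partitions) of $n$ into powers of $2$, i.e. the number of finite sequences $(q_1,\ldots,q_\ell)$ of non-negative integers (any length $\ell\ge 1$) with $n=2^{q_1}+\cdots+2^{q_\ell}$. For a positive integer $m$, $s_2(m)$ denotes the number of $1$'s in the binary expansion of $m$. *)

(* Defs.v *)
From mathcomp Require Import all_boot.

Set Implicit Arguments.
Unset Strict Implicit.
Unset Printing Implicit Defensive.

(* A sequence (q_1, ..., q_l) with l >= 1 and n = 2^q_1 + ... + 2^q_l. *)
Definition is_comp2 (n : nat) (q : seq nat) : bool :=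
  (0 < size q) && (\sum_(i <- q) 2 ^ i == n).

(* The number of such sequences.  Since 2^q >= 1 and q < 2^q, each of them has
   length at most n and entries below n, so the count ranges over a finite set;
   [v_spec] below shows that no sequence is lost by these bounds. *)
Definition v (n : nat) : nat :=
  \sum_(1 <= l < n.+1)
    #|[set q : l.-tuple 'I_n | is_comp2 n [seq val i | i <- q]]|.

(* For 0 < m the binary digits of m sit at positions i < m, as m < 2^m. *)
Definition s2 (m : nat) : nat := \sum_(i < m) odd (m %/ 2 ^ i).

Lemma comp2_bounds n q : is_comp2 n q ->
  size q <= n /\ {in q, forall i, i < n}.
Proof.
case/andP=> _ /eqP <-; split.
  by rewrite -sum1_size; apply: leq_sum => i _; rewrite expn_gt0.
move=> i iq; apply: (leq_trans (ltn_expl i (ltnSn 1))).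
by rewrite (big_rem i iq) leq_addr.
Qed.

Lemma v_spec n : exists s : seq (seq nat),
  [/\ uniq s, forall q, (q \in s) = is_comp2 n q & size s = v n].
Proof.
pose f l (q : l.-tuple 'I_n) := [seq val i | i <- q].
pose s := undup [seq q <- flatten
  [seq [seq f l q | q <- enum {: l.-tuple 'I_n}] | l <- iota 0 n.+1]
  | is_comp2 n q].
have us : uniq s by apply: undup_uniq.
have insubE q : is_comp2 n q ->
    [seq val i | i <- pmap (insub : nat -> option 'I_n) q] = q.
  move=> qc; have [_ qn] := comp2_bounds qc.
  rewrite (pmap_filter (insubK _)); apply/all_filterP/allP => i iq.
  by rewrite isSome_insub; apply: qn.
have sE q : (q \in s) = is_comp2 n q.
  rewrite mem_undup mem_filter; case: (boolP (is_comp2 n q)) => // qc; rewrite andTb.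
  apply: (introT flattenP); exists [seq f (size q) r | r <- enum {: (size q).-tuple 'I_n}].
    apply/mapP; exists (size q) => //.
    by rewrite mem_iota /= add0n ltnS; case: (comp2_bounds qc).
  have st : size (pmap (insub : nat -> option 'I_n) q) == size q.
    by rewrite -(size_map val) insubE.
  by apply/mapP; exists (Tuple st); rewrite ?mem_enum // /f /= insubE.
exists s; split=> //; apply/esym; move: (s) us sE => {}s us sE.
pose S l := [set q : l.-tuple 'I_n | is_comp2 n [seq val i | i <- q]].
have SE l : 0 < l -> #|S l| = count (fun q => size q == l) s.
  move=> l0; rewrite -size_filter cardE.
  rewrite -(size_map (fun q : l.-tuple 'I_n => [seq val i | i <- q])).
  apply/perm_size/uniq_perm.
  - rewrite map_inj_uniq ?enum_uniq // => q r /(inj_map val_inj) qr.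
    exact: val_inj.
  - exact: filter_uniq.
  move=> q; rewrite mem_filter sE; apply/mapP/andP.
    by case=> r; rewrite mem_enum inE => rc ->; rewrite size_map size_tuple.
  case=> /eqP sq qc.
  have qE := insubE q qc.
  have st : size (pmap (insub : nat -> option 'I_n) q) == l.
    by rewrite -(size_map val) qE sq.
  by exists (Tuple st) => //=; rewrite mem_enum inE /= qE.
rewrite /v big_nat_cond.
under eq_bigr => l /andP[/andP[l0 _] _] do rewrite (SE l l0) -sum1_count big_mkcond /=.
rewrite -big_nat_cond exchange_big /= -sum1_size big_seq [RHS]big_seq.
apply: eq_bigr => q; rewrite sE => qc.
have [qn _] := comp2_bounds qc; case/andP: (qc) => q0 _.
rewrite (bigD1_seq (size q)) ?mem_index_iota ?iota_uniq ?q0 //= eqxx.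
by rewrite big1 // => l /negPf; rewrite eq_sym => ->.
Qed.

(* Main.v *)
Require Import Defs.
From mathcomp Require Import all_boot.
From mathcomp Require Import all_algebra.
From mathcomp Require Import ring zify.

(** With [F = sum_q X^(2^q)], the generating function of [v] is [1 / (1 - F)].
    Modulo 2, squaring shifts the terms of [F], so [F (1 - F) = X]; raising this
    to the power [a = 2^(N-1)] gives [(F (1 - F))^a = X^a] modulo [2^N], whence
    [X^a / (1 - F) = F^a (1 - F)^(a-1)] modulo [2^N].  The right-hand side is a
    polynomial of degree [2a - 1 < 2^N] in [F], and an exponent [m] occurring in
    [F^j] is a sum of [j] powers of 2, so [s2 m <= j]. *)

Set Implicit Arguments.
Unset Strict Implicit.
Unset Printing Implicit Defensive.

Import GRing.Theory.

Lemma s2_widen m k : m <= k -> s2 m = \sum_(i < k) odd (m %/ 2 ^ i).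
Proof.
move=> mk; rewrite /s2 -!(big_mkord predT (fun i => nat_of_bool (odd (m %/ 2 ^ i)))).
rewrite [RHS](@big_cat_nat _ _ _ m) //= -[LHS]addn0; congr (_ + _).
rewrite big_nat_cond big1 // => i /andP[/andP[mi _] _]; rewrite divn_small //.
exact: leq_ltn_trans mi (ltn_expl i (ltnSn 1)).
Qed.

Lemma s2_half m : s2 m = odd m + s2 m./2.
Proof.
rewrite (s2_widen (leqnSn m)) big_ord_recl /= expn0 divn1; congr (_ + _).
rewrite (@s2_widen _ m); last by lia.
by apply: eq_bigr => i _; rewrite /bump /= add1n expnS -divn2 divnMA.
Qed.

Lemma s2_0 : s2 0 = 0.
Proof. by rewrite /s2 big_ord0. Qed.

Lemma s2_pow2 q : s2 (2 ^ q) = 1.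
Proof.
elim: q => [|q IHq]; first by rewrite s2_half s2_0.
by rewrite s2_half expnS mul2n doubleK odd_double IHq.
Qed.

(** Schoolbook binary addition: the incoming carry [c] lets the induction pass to the halves, where
    the lowest digits hand on a new carry. *)
Lemma s2_add_carry (c : bool) m n : s2 (c + m + n) <= c + s2 m + s2 n.
Proof.
move: {2}(m + n) (leqnn (m + n)) => k.
elim/ltn_ind: k c m n => k IHk c m n mnk.
have [mn0|mn0] := posnP (m + n).
  have [-> ->] : m = 0 /\ n = 0 by lia.
  by rewrite !s2_0 !addn0; case: c; rewrite ?s2_0 // (s2_pow2 0).
(* The outgoing carry: the majority of [c] and the two lowest digits. *)
pose d := if c then odd m || odd n else odd m && odd n.
have half_sum : (c + m + n)./2 = d + m./2 + n./2.
  by rewrite /d; case: c {d}; lia.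
have IH := IHk (m./2 + n./2) ltac:(lia) d m./2 n./2 (leqnn _).
have odd_sum : odd (c + m + n) + d <= c + odd m + odd n.
  by rewrite /d !oddD; case: c {d half_sum IH}; case: (odd m); case: (odd n).
rewrite s2_half (s2_half m) (s2_half n) half_sum; lia.
Qed.

Lemma s2D m n : s2 (m + n) <= s2 m + s2 n.
Proof. exact: (s2_add_carry false). Qed.

Local Open Scope ring_scope.

Section SparsePolynomials.

Variable R : comNzRingType.

(** By subadditivity of [s2], the bounds [d] add under products, so [d] behaves like a degree in
    [F]. *)
Definition s2_sparse (d : nat) (p : {poly R}) :=
  forall m, (d < s2 m)%N -> p`_m = 0.

Lemma s2_sparse_leq d e p : (d <= e)%N -> s2_sparse d p -> s2_sparse e p.
Proof. by move=> de sp m em; apply: sp; apply: leq_ltn_trans de em. Qed.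

Lemma s2_sparse1 : s2_sparse 0 1.
Proof. by case=> [|m]; rewrite ?s2_0 // coef1. Qed.

Lemma s2_sparseB d p q : s2_sparse d p -> s2_sparse d q -> s2_sparse d (p - q).
Proof. by move=> sp sq m dm; rewrite coefB sp ?sq ?subrr. Qed.

Lemma s2_sparseM d e p q :
  s2_sparse d p -> s2_sparse e q -> s2_sparse (d + e) (p * q).
Proof.
move=> sp sq m dem; rewrite coefM big1 // => i _.
have [di|id] := ltnP d (s2 i); first by rewrite sp ?mul0r.
rewrite (sq (m - i)%N) ?mulr0 //.
have := s2D i (m - i); rewrite subnKC -1?ltnS //; lia.
Qed.

Lemma s2_sparseX d p k : s2_sparse d p -> s2_sparse (k * d) (p ^+ k).
Proof.
move=> sp; elim: k => [|k IHk]; first exact: s2_sparse1.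
by rewrite exprS mulSn; apply: s2_sparseM.
Qed.

End SparsePolynomials.

Definition pow2_poly (k : nat) : {poly int} := \sum_(q < k) 'X^(2 ^ q).

Lemma s2_sparse_pow2_poly k : s2_sparse 1 (pow2_poly k).
Proof.
move=> m m1; rewrite coef_sum big1 // => q _; rewrite coefXn.
by case: eqP => // mq; rewrite mq s2_pow2 in m1.
Qed.

(** The relation [F (1 - F) = X] modulo 2 for truncated [F]; ['X^(2 ^ k)] is the truncation
    error. *)
Lemma pow2_poly_mod2 k : exists r : {poly int},
  pow2_poly k * (1 - pow2_poly k) = 'X - 'X^(2 ^ k) + 2 * r.
Proof.
elim: k => [|k [r IHk]].
  by exists 0; rewrite /pow2_poly big_ord0 expn0 expr1; ring.
(* Adding [y = 'X^(2 ^ k)] to [f] changes [f * (1 - f)] by [y - y ^+ 2 - 2 * (f * y)]: [y] cancels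
   the old error, [y ^+ 2] is the new one. *)
exists (r - pow2_poly k * 'X^(2 ^ k)).
have -> : pow2_poly k.+1 = pow2_poly k + 'X^(2 ^ k).
  by rewrite /pow2_poly big_ord_recr.
rewrite expnS mulnC exprM.
move: IHk; move: (pow2_poly k) ('X^(2 ^ k)) => f y IHk.
have -> : (f + y) * (1 - (f + y)) = f * (1 - f) + y - 2 * (f * y) - y ^+ 2 by ring.
by rewrite IHk; ring.
Qed.

Lemma pow2_poly_dvdX k : exists g, pow2_poly k = 'X * g.
Proof.
exists (\sum_(q < k) 'X^((2 ^ q).-1)); rewrite mulr_sumr.
by apply: eq_bigr => q _; rewrite -exprS prednK ?expn_gt0.
Qed.

(** Each squaring of a congruence modulo a power of 2 gains one more factor 2. *)
Lemma exp_pow2_mod (R : comNzRingType) (p q r : R) k : p = q + 2 * r ->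
  exists r', p ^+ (2 ^ k) = q ^+ (2 ^ k) + (2 ^ k.+1)%:R * r'.
Proof.
move=> pq; elim: k => [|k [s IHk]]; first by exists r.
exists (q ^+ (2 ^ k) * s + (2 ^ k)%:R * s ^+ 2).
rewrite [in p ^+ _]expnS [in q ^+ _]expnS mulnC !exprM IHk !expnS !natrM.
by move: (q ^+ _) ((2 ^ k)%:R) => x y; ring.
Qed.

Lemma subr1X_exp (R : comNzRingType) (y : R) k : exists s, (1 - y) ^+ k = 1 + y * s.
Proof.
elim: k => [|k [s IHk]]; first by exists 0; rewrite mulr0 addr0.
by exists (s - 1 - y * s); rewrite exprS IHk; ring.
Qed.

Lemma coef_sumX_exp (R : comNzRingType) (T : finType) (w : T -> nat) l n :
  ((\sum_t 'X^(w t) : {poly R}) ^+ l)`_n =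
  #|[set q : l.-tuple T | \sum_(i <- q) w i == n]%N|%:R.
Proof.
have -> : (\sum_t 'X^(w t) : {poly R}) ^+ l =
    \sum_(q : l.-tuple T) 'X^(\sum_(i <- q) w i)%N.
  rewrite -[l in LHS]card_ord -prodr_const bigA_distr_bigA /=.
  (* Distributing the product gives a sum over functions ['I_l -> T], which are identified with
     tuples. *)
  rewrite (reindex (fun q : l.-tuple T => [ffun i => tnth q i])) /=.
    apply: eq_bigr => q _; rewrite big_tuple expr_sum.
    by apply: eq_bigr => i _; rewrite ffunE.
  exists (fun f : {ffun 'I_l -> T} => [tuple f i | i < l]) => [q _|f _].
    by apply: eq_from_tnth => i; rewrite tnth_mktuple ffunE.
  by apply/ffunP => i; rewrite ffunE tnth_mktuple.
rewrite coef_sum cardsE -sum1_card natr_sum.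
rewrite [RHS]big_mkcond; apply: eq_bigr => q _.
by rewrite coefXn eq_sym unfold_in -[eqn _ _]/(_ == _); case: eqP.
Qed.

Lemma v_coef n : (0 < n)%N ->
  (v n)%:R = (\sum_(l < n.+1) pow2_poly n ^+ l)`_n.
Proof.
move=> n0; rewrite coef_sum big_ord_recl expr0 coef1 gtn_eqF // add0r.
rewrite /v big_add1 big_mkord natr_sum; apply: eq_bigr => l _.
rewrite coef_sumX_exp; congr (_ %:R); apply: eq_card => q.
by rewrite !inE /is_comp2 size_map size_tuple big_map.
Qed.

Lemma coef_mul_natr_dvdz (c : nat) (p : {poly int}) i :
  (c%:Z %| (c%:R * p)`_i)%Z.
Proof. by rewrite mulr_natl coefMn -mulr_natl natz dvdz_mulr. Qed.

Lemma dvdz_v n k : (1 < n)%N -> (2 ^ k.+1 <= s2 (n + 2 ^ k))%N ->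
  ((2 ^ k.+1)%N%:Z %| (v n)%:Z)%Z.
Proof.
move=> n1 hs.
(* Puts the truncation error of [F] out of reach of the coefficient [n]; it fails for [n = 1]. *)
have n2n : (n < (2 ^ n).-1)%N.
  case: n n1 {hs} => // n n1.
  have := ltn_expl n (ltnSn 1); rewrite expnS; lia.
set a := (2 ^ k)%N in hs.
have a0 : (0 < a)%N by rewrite expn_gt0.
have aE : (2 ^ k.+1 = 2 * a)%N by rewrite expnS.
pose F := pow2_poly n; pose V := \sum_(l < n.+1) F ^+ l.
have FV : (1 - F) * V = 1 - F ^+ n.+1.
  by rewrite -[in RHS](expr1n _ n.+1) subrXX; congr (_ * _);
     apply: eq_bigr => i _; rewrite expr1n mul1r.
have [r Fr] := pow2_poly_mod2 n.
have [s Fs] := exp_pow2_mod k Fr.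
have [t Ht] := subr1X_exp ('X^((2 ^ n).-1) : {poly int}) a.
have [g Fg] := pow2_poly_dvdX n.
have XE : ('X - 'X^(2 ^ n) : {poly int}) = 'X * (1 - 'X^((2 ^ n).-1)).
  by rewrite mulrBr mulr1 -exprS prednK ?expn_gt0.
rewrite XE exprMn [in RHS]exprMn -/a -/F Ht in Fs.
(* This is [Fs] times [V], where [V] inverts [1 - F] up to [F ^+ n.+1]; the subtracted term is that
   defect, divisible by a high power of ['X]. *)
have key : F ^+ a * (1 - F) ^+ a.-1 - 'X^((n + a).+1) * (g ^+ (n + a).+1 * (1 - F) ^+ a.-1)
   = 'X^a * V + 'X^a * ('X^((2 ^ n).-1) * (t * V)) + (2 ^ k.+1)%:R * (s * V).
  have -> : 'X^a * V + 'X^a * ('X^((2 ^ n).-1) * (t * V)) + (2 ^ k.+1)%:R * (s * V)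
     = ('X^a * (1 + 'X^((2 ^ n).-1) * t) + (2 ^ k.+1)%:R * s) * V by ring.
  rewrite -Fs [X in _ - X]mulrA -[X in _ - X * _]exprMn -Fg -/F -addSn exprD.
  have -> : (1 - F) ^+ a = (1 - F) ^+ a.-1 * (1 - F) by rewrite -exprSr prednK.
  by rewrite -!mulrA FV; ring.
have sparse : s2_sparse (a * 1 + a.-1 * 1) (F ^+ a * (1 - F) ^+ a.-1).
  apply: s2_sparseM; apply: s2_sparseX; first exact: s2_sparse_pow2_poly.
  apply: s2_sparseB; last exact: s2_sparse_pow2_poly.
  exact: s2_sparse_leq (@s2_sparse1 _).
(* At degree [n + a] the left side vanishes, since [2 * a - 1 < s2 (n + a)]; the right side leaves
   [v n] plus a multiple of [2 ^ k.+1]. *)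
move/(congr1 (fun p : {poly int} => p`_(n + a))): key.
rewrite coefB sparse; last by lia.
rewrite coefXnM ltnSn subrr !coefD !['X^a * _]mulrC !coefMXn ltnNge leq_addl /= addnK.
rewrite coefXnM n2n addr0 -v_coef ?(ltnW n1) // natz => /esym/eqP.
rewrite addr_eq0 => /eqP ->; rewrite dvdzE abszN -dvdzE.
exact: coef_mul_natr_dvdz.
Qed.

Local Close Scope ring_scope.

Theorem theorem2 (n N : nat) (hn : 1 <= n) (hN : 1 <= N)
    (hs : 2 ^ N <= s2 (n + 2 ^ (N - 1))) :
  v n = 0 %[mod 2 ^ N].
Proof.
case: N hN hs => // k _; rewrite subn1 /= => hs.
have n1 : 1 < n.
  (* For [n = 1] the digit sum is at most 2, and it is 1 when [k = 0], always below [2 ^ k.+1]. *)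
  case: n hn hs => [//|[_|//]]; have := s2D 1 (2 ^ k).
  rewrite s2_pow2 (s2_pow2 0); case: k => [|k]; first by rewrite (s2_pow2 1).
  have := expn_gt0 2 k; rewrite !expnS /=; lia.
by apply/eqP; rewrite mod0n; exact: (dvdz_v n1 hs).
Qed.
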